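(* Let $M_1,\ldots,M_n$ be smooth manifolds (each finite-dimensional, or an infinite-dimensional Banach manifold), let $M=M_1\times\cdots\times M_n$, and let $f_1,\ldots,f_n\in C^2(M,\mathbb{R})$ be the players' cost functions. If $u=(u_1,\ldots,u_n)\in M$ is a differential Nash equilibrium of the game $(f_1,\ldots,f_n)$, then $u$ is a strict local Nash equilibrium of $(f_1,\ldots,f_n)$.
   Context: Game: there are $n$ players; player $i$ chooses a strategy $u_i\in M_i$ and wants to minimize $f_i$. Each $M_i$ is a second-countable Hausdorff smooth manifold modeled on a Banach space $E_i$ (finite- or infinite-dimensional). Charts on $M$ are taken to be product charts $(U,\varphi)$ with $U=U_1\times\cdots\times U_n$, $\varphi=\varphi_1\times\cdots\times\varphi_n$, where $(U_i,\varphi_i)$ is a chart on $M_i$. Strict local Nash equilibrium: $(u_1,\ldots,u_n)\in M$ is a strict local Nash equilibrium if there exist open sets $W_i\subset M_i$ with $u_i\in W_i$ such that for each $i$, $f_i(u_1,\ldots,u_i,\ldots,u_n)< f_i(u_1,\ldots,u_i',\ldots,u_n)$ for all $u_i'\in W_i\setminus\{u_i\}$ (only the $i$-th coordinate is changed). Partial derivatives: $D_if_j(u)\in T^*_{u_i}M_i$ is the derivative at $u_i$ of the map $\mu_i\mapsto f_j(u_1,\ldots,u_{i-1},\mu_i,u_{i+1},\ldots,u_n)$ on $M_i$. Differential game form: $\omega=\sum_{i=1}^n\psi_{M_i}\circ df_i:M\to T^*M$, where, under the canonical splitting $T^*_{u}M\cong T^*_{u_1}M_1\oplus\cdots\oplus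 T^*_{u_n}M_n$, the bundle map $\psi_{M_i}$ sends $(\omega_1,\ldots,\omega_n)$ to $(0,\ldots,0,\omega_i,0,\ldots,0)$. Thus $\omega(u)=(D_1f_1(u),\ldots,D_nf_n(u))$. Differential Nash equilibrium: $u\in M$ is a differential Nash equilibrium if $\omega(u)=0$ and $D_{ii}^2f_i(u)$ is positive-definite for each $i\in\{1,\ldots,n\}$. Here, when $D_if_i(u)=0$, $D_{ii}^2f_i(u)=D_i(D_if_i)(u)$ is the Hessian at the critical point $u_i$ of $\mu_i\mapsto f_i(u_1,\ldots,\mu_i,\ldots,u_n)$, a continuous symmetric bilinear form on $T_{u_i}M_i$, computed in a chart as $D_{ii}^2(f_i\circ\varphi^{-1})(\varphi(u))$. It is called positive-definite if there is $\alpha> 0$ such that, in a chart, $D_{ii}^2(f_i\circ\varphi^{-1})(\varphi(u))(\nu,\nu)\ge\alpha\|\nu\|^2$ for all $\nu\in E_i$ (the existence of such an $\alpha$ does not depend on the chart). *)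

(* Defs.v *)
From HB Require Import structures.
From mathcomp Require Import all_boot all_order all_algebra.
From mathcomp Require Import all_classical all_reals all_analysis.

Set Implicit Arguments.
Unset Strict Implicit.
Unset Printing Implicit Defensive.

Import Order.TTheory GRing.Theory Num.Theory.
Import numFieldNormedType.Exports.

Local Open Scope classical_set_scope.
Local Open Scope ring_scope.

Section ContinuousLinearMaps.
Context {R : realType} {E F : normedModType R}.

Definition clin_pred : {pred E -> F} :=
  [pred A : E -> F | `[< linear A /\ continuous A >]].

(* The normed space L(E, F), with the operator norm. *)
Record clin := Clin { clin_fun :> E -> F; clinP : clin_fun \in clin_pred }.

HB.instance Definition _ := [isSub for clin_fun].
HB.instance Definition _ := [Choice of clin by <:].

Lemma clin_submod_closed : submod_closed clin_pred.
Proof.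
split=> [|a A B /asboolP[lA cA] /asboolP[lB cB]].
  apply/asboolP; split=> [b x y|x]; first by rewrite /= scaler0 addr0.
  exact: cvg_cst.
apply/asboolP; split=> [b x y|x].
  by rewrite !fctE lA lB !scalerDr !scalerA (mulrC a) addrACA.
by apply: cvgD; [apply: cvgZl_tmp; exact: cA|exact: cB].
Qed.

HB.instance Definition _ :=
  GRing.isSubmodClosed.Build R (E -> F) clin_pred clin_submod_closed.
HB.instance Definition _ := [SubChoice_isSubLmodule of clin by <:].

Lemma clin_linear (A : clin) : linear A.
Proof. by case: A => A /= /asboolP[]. Qed.

Lemma clin_continuous (A : clin) : continuous A.
Proof. by case: A => A /= /asboolP[]. Qed.

HB.instance Definition _ (A : clin) :=
  GRing.isLinear.Build R E F _ (clin_fun A) (clin_linear A).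

Definition clin_norm (A : clin) : R :=
  sup [set `|A x| | x in [set x : E | `|x| <= 1]].

Lemma clin_has_sup (A : clin) :
  has_sup [set `|A x| | x in [set x : E | `|x| <= 1]].
Proof.
split; first by exists `|A 0|, 0 => //=; rewrite normr0.
have /linear_boundedP[c [_ cA]] :=
  continuous_linear_bounded 0 (@clin_continuous A 0).
near (pinfty_nbhs R) => r.
have r0 : 0 <= r by near: r; apply: nbhs_pinfty_ge; rewrite num_real.
exists r => _ [x /= x1 <-].
apply: (le_trans (cA r _ x)); last by rewrite -[leRHS]mulr1 ler_wpM2l.
by near: r; apply: nbhs_pinfty_gt; rewrite num_real.
Unshelve. all: by end_near. Qed.

Lemma clin_norm_ge (A : clin) (x : E) : `|x| <= 1 -> `|A x| <= clin_norm A.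
Proof.
by move=> x1; apply: (sup_upper_bound (clin_has_sup A)); exists x.
Qed.

Lemma clin_norm_le (A : clin) (x : E) : `|A x| <= clin_norm A * `|x|.
Proof.
have [->|x0] := eqVneq x 0; first by rewrite linear0 !normr0 mulr0.
have nx : 0 < `|x| by rewrite normr_gt0.
rewrite -ler_pdivrMr// mulrC -[X in X * _](ger0_norm (ltW _)) ?invr_gt0//.
rewrite -normrZ -linearZ; apply: clin_norm_ge.
by rewrite normrZ normfV normr_id mulVf// gt_eqF.
Qed.

Lemma clin_norm_lub (A : clin) (c : R) :
  (forall x, `|x| <= 1 -> `|A x| <= c) -> clin_norm A <= c.
Proof.
move=> Ac; apply: ge_sup; first by case: (clin_has_sup A).
by move=> _ [x /= x1 <-]; exact: Ac.
Qed.

Lemma clin_normD (A B : clin) :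
  clin_norm (A + B) <= clin_norm A + clin_norm B.
Proof.
apply: clin_norm_lub => x x1; apply: le_trans (ler_normD _ _) _.
by apply: lerD; exact: clin_norm_ge.
Qed.

Lemma clin_normZ (a : R) (A : clin) : clin_norm (a *: A) = `|a| * clin_norm A.
Proof.
have leZ b (B : clin) : clin_norm (b *: B) <= `|b| * clin_norm B.
  apply: clin_norm_lub => x x1; rewrite [X in `|X|](_ : _ = b *: B x)//.
  by rewrite normrZ ler_wpM2l// clin_norm_ge.
apply/eqP; rewrite eq_le leZ /=; have [->|a0] := eqVneq a 0.
  rewrite normr0 mul0r; apply: le_trans (normr_ge0 _) (clin_norm_ge _ _) => //.
  by instantiate (1 := 0); rewrite normr0.
rewrite mulrC -ler_pdivlMr ?normr_gt0// mulrC -normfV.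
by apply: le_trans (leZ _ _); rewrite scalerA mulVf// scale1r.
Qed.

Lemma clin_norm_eq0 (A : clin) : clin_norm A = 0 -> A = 0.
Proof.
move=> A0; apply: val_inj; apply/funext => x; apply/eqP.
by rewrite -normr_le0; apply: le_trans (clin_norm_le A x) _; rewrite A0 mul0r.
Qed.

HB.instance Definition _ :=
  Lmodule_isNormed.Build R clin clin_normD clin_normZ clin_norm_eq0.

End ContinuousLinearMaps.

Arguments clin {R} E F.

Section Smoothness.
Context {R : realType}.

(* Junk value 0 when the linear map ['d f x] is not continuous; it always is
   when [f] is Frechet differentiable at [x]. *)
Definition frechet {E F : normedModType R} (f : E -> F) (x : E) : clin E F :=
  insubd 0 ('d f x : E -> F).

Lemma frechetE {E F : normedModType R} (f : E -> F) (x : E) :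
  differentiable f x -> frechet f x = 'd f x :> (E -> F).
Proof.
move=> dfx; rewrite /frechet insubdK//; apply/asboolP; split.
  exact: linearP.
exact: diff_continuous.
Qed.

(* [U] is meant to be open.  C^(k+1) means Frechet differentiable with a
   derivative U -> L(E, F) that is C^k for the operator norm. *)
Fixpoint Ck_on (k : nat) {E F : normedModType R} (U : set E) (f : E -> F) :
    Prop :=
  if k is k'.+1 then
    (forall x, U x -> differentiable f x) /\ Ck_on k' U (frechet f)
  else forall x, U x -> {for x, continuous f}.

Definition smooth_on {E F : normedModType R} (U : set E) (f : E -> F) : Prop :=
  forall k, Ck_on k U f.

End Smoothness.

Section Manifolds.
Context {R : realType} {E : completeNormedModType R}.

(* A chart is a homeomorphism from the open set [cdom] onto the open set
   [cfun @` cdom]; the values of [cfun] and [cinv] elsewhere are irrelevant. *)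
Record chart (M : topologicalType) := Chart {
  cdom : set M;
  cfun : M -> E;
  cinv : E -> M;
  cdom_open : open cdom;
  cimg_open : open (cfun @` cdom);
  cfunK : forall p, cdom p -> cinv (cfun p) = p;
  cfun_continuous : forall p, cdom p -> {for p, continuous cfun};
  cinv_continuous : forall x, (cfun @` cdom) x -> {for x, continuous cinv}
}.

(* The atlas need not be maximal: C^2 regularity, the vanishing of a covector and
   the positive-definiteness of a Hessian at a critical point can be tested on
   any atlas. *)
Record banachManifold := BanachManifold {
  carrier :> topologicalType;
  atlas : set (chart carrier);
  carrier_hausdorff : hausdorff_space carrier;
  carrier_second_countable : @second_countable carrier;
  atlas_cover : forall p, exists2 c, atlas c & cdom c p;
  atlas_smooth : forall c d, atlas c -> atlas d ->
    smooth_on (cfun c @` (cdom c `&` cdom d)) (cfun d \o cinv c)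
}.

End Manifolds.

Arguments chart {R} E M.
Arguments banachManifold {R} E.

(* E_1 x ... x E_n with the maximum norm. *)
Definition bprod {R : realType} {n : nat} (E : 'I_n -> completeNormedModType R) : Type :=
  forall i, E i.

Section ProductNorm.
Context {R : realType} {n : nat} {E : 'I_n -> completeNormedModType R}.
Implicit Types x y z : bprod E.

HB.instance Definition _ := gen_eqMixin (bprod E).
HB.instance Definition _ := gen_choiceMixin (bprod E).

Let bzero : bprod E := fun=> 0.
Let bopp x : bprod E := fun i => - x i.
Let badd x y : bprod E := fun i => x i + y i.
Let bscale (a : R) x : bprod E := fun i => a *: x i.

Let baddA : associative badd.
Proof. by move=> x y z; apply: functional_extensionality_dep => i; exact: addrA. Qed.
Let baddC : commutative badd.
Proof. by move=> x y; apply: functional_extensionality_dep => i; exact: addrC. Qed.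
Let badd0 : left_id bzero badd.
Proof. by move=> x; apply: functional_extensionality_dep => i; exact: add0r. Qed.
Let baddN : left_inverse bzero bopp badd.
Proof. by move=> x; apply: functional_extensionality_dep => i; exact: addNr. Qed.

HB.instance Definition _ :=
  GRing.isZmodule.Build (bprod E) baddA baddC badd0 baddN.

Let bscaleA (a b : R) x : bscale a (bscale b x) = bscale (a * b) x.
Proof. by apply: functional_extensionality_dep => i; exact: scalerA. Qed.
Let bscale1 : left_id 1 bscale.
Proof. by move=> x; apply: functional_extensionality_dep => i; exact: scale1r. Qed.
Let bscaleDr : right_distributive bscale +%R.
Proof. by move=> a x y; apply: functional_extensionality_dep => i; exact: scalerDr. Qed.
Let bscaleDl x : {morph bscale^~ x : a b / a + b}.
Proof. by move=> a b; apply: functional_extensionality_dep => i; exact: scalerDl. Qed.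

HB.instance Definition _ := GRing.Zmodule_isLmodule.Build R (bprod E)
  bscaleA bscale1 bscaleDr bscaleDl.

Definition bprod_norm x : R := \big[Num.max/0]_(i < n) `|x i|.

Lemma bprod_norm_ge x i : `|x i| <= bprod_norm x.
Proof. exact: (le_bigmax _ (fun i => `|x i|)). Qed.

Lemma bprod_norm_ge0 x : 0 <= bprod_norm x.
Proof. exact: bigmax_ge_id. Qed.

Lemma bprod_norm_lub x (c : R) :
  0 <= c -> (forall i, `|x i| <= c) -> bprod_norm x <= c.
Proof. by move=> c0 xc; apply: bigmax_le. Qed.

Lemma bprod_normD x y : bprod_norm (x + y) <= bprod_norm x + bprod_norm y.
Proof.
apply: bprod_norm_lub => [|i]; first by rewrite addr_ge0// bprod_norm_ge0.
by apply: le_trans (ler_normD _ _) (lerD _ _); exact: bprod_norm_ge.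
Qed.

Lemma bprod_normZ (a : R) x : bprod_norm (a *: x) = `|a| * bprod_norm x.
Proof.
have leZ b y : bprod_norm (b *: y) <= `|b| * bprod_norm y.
  apply: bprod_norm_lub => [|i]; first by rewrite mulr_ge0// bprod_norm_ge0.
  by rewrite [X in `|X|](_ : _ = b *: y i)// normrZ ler_wpM2l// bprod_norm_ge.
apply/eqP; rewrite eq_le leZ /=; have [->|a0] := eqVneq a 0.
  by rewrite normr0 mul0r bprod_norm_ge0.
rewrite mulrC -ler_pdivlMr ?normr_gt0// mulrC -normfV.
by apply: le_trans (leZ _ _); rewrite scalerA mulVf// scale1r.
Qed.

Lemma bprod_norm_eq0 x : bprod_norm x = 0 -> x = 0.
Proof.
move=> x0; apply: functional_extensionality_dep => i; apply/eqP.
by rewrite -normr_le0 -x0 bprod_norm_ge.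
Qed.

HB.instance Definition _ :=
  Lmodule_isNormed.Build R (bprod E) bprod_normD bprod_normZ bprod_norm_eq0.

(* The endomorphism keeping the [i]-th component and cancelling the others; its
   transpose [psi i] sends (l_1, ..., l_n) to (0, ..., 0, l_i, 0, ..., 0). *)
Definition keep (i : 'I_n) x : bprod E := fun j => if j == i then x j else 0.

Lemma keep_linear (i : 'I_n) : linear (keep i).
Proof.
move=> a x y; apply: functional_extensionality_dep => j.
have E1 (v w : bprod E) : (a *: v + w) j = a *: v j + w j by [].
by rewrite E1 /keep; case: eqP => // _; rewrite scaler0 addr0.
Qed.

Lemma keep_continuous (i : 'I_n) : continuous (keep i).
Proof.
move=> x; apply/(@cvgrPdist_lt _ _ _ (nbhs x)) => e e0; near=> y.
rewrite (_ : keep i x - keep i y = keep i (x - y)); last first.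
  apply: functional_extensionality_dep => j.
  have E1 (v w : bprod E) : (v - w) j = v j - w j by [].
  by rewrite E1 /keep; case: eqP => // _; rewrite subr0.
apply: (@le_lt_trans _ _ `|x - y|); last first.
  near: y; exact: (@cvgr_dist_lt _ _ _ (nbhs x) _ id x cvg_id).
apply: bprod_norm_lub => [|j]; first exact: bprod_norm_ge0.
by rewrite /keep; case: eqP => _; rewrite ?normr0 ?bprod_norm_ge0 ?bprod_norm_ge.
Unshelve. all: by end_near. Qed.

Lemma psi_subproof (i : 'I_n) (l : clin (bprod E) R) :
  (fun x => l (keep i x)) \in @clin_pred R (bprod E) R.
Proof.
apply/asboolP; split=> [a x y|x]; first by rewrite keep_linear linearP.
by apply: continuous_comp; [exact: keep_continuous|exact: clin_continuous].
Qed.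

Definition psi (i : 'I_n) (l : clin (bprod E) R) : clin (bprod E) R :=
  Clin (psi_subproof i l).

End ProductNorm.

Section PartialDerivatives.
Context {R : realType} {n : nat} {E : 'I_n -> completeNormedModType R}.
Implicit Types x : bprod E.

(* The partial derivatives D_i F(x) in L(E_i, G) and D_ii^2 F(x) in
   L(E_i, L(E_i, R)), as derivatives in the [i]-th variable alone. *)
Definition pderiv {G : normedModType R} (i : 'I_n) (F : bprod E -> G) x :
    clin (E i) G :=
  frechet (fun y : E i => F (dfwith x i y)) (x i).

Definition pderiv2 (i : 'I_n) (F : bprod E -> R) x : clin (E i) (clin (E i) R) :=
  frechet (fun y : E i => pderiv i F (dfwith x i y)) (x i).

End PartialDerivatives.

Section Games.
Context {R : realType} {n : nat} {E : 'I_n -> completeNormedModType R}.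
Context {M : forall i, banachManifold (E i)}.

Definition pchart : Type := forall i, chart (E i) (M i).

Implicit Types (c : pchart) (u : forall i, M i) (g : (forall i, M i) -> R).

Definition product_atlas : set pchart := [set c | forall i, atlas (c i)].

Definition pchart_dom c : set (forall i, M i) := [set u | forall i, cdom (c i) (u i)].

Definition pchart_fun c u : bprod E := fun i => cfun (c i) (u i).

Definition pchart_inv c (x : bprod E) : forall i, M i := fun i => cinv (c i) (x i).

Definition C2 g : Prop :=
  forall c, product_atlas c -> Ck_on 2 (pchart_fun c @` pchart_dom c) (g \o pchart_inv c).

(* A covector in T*_u M is handled through its representatives in L(E, R), one
   for each product chart [c] at [u], where E = E_1 x ... x E_n.  The following
   is the representative of dg(u).  Representatives in two charts at [u] differ
   by the derivative of the change of charts, so a covector is zero when all of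
   its representatives are. *)
Definition cost_diff g c u : clin (bprod E) R := frechet (g \o pchart_inv c) (pchart_fun c u).

(* The representative of omega(u), where omega is the sum of the psi_i o df_i. *)
Definition game_form (f : 'I_n -> (forall i, M i) -> R) c u :
    clin (bprod E) R :=
  \sum_(i < n) psi i (cost_diff (f i) c u).

Definition game_form_vanishes (f : 'I_n -> (forall i, M i) -> R) u : Prop :=
  forall c, product_atlas c -> pchart_dom c u -> game_form f c u = 0.

(* At a critical point of the [i]-th slice of [g], positive-definiteness of the
   Hessian does not depend on the chart. *)
Definition hessian_posdef (i : 'I_n) g u : Prop :=
  exists c, [/\ product_atlas c, pchart_dom c u &
    exists2 alpha : R, 0 < alpha & forall v : E i,
      alpha * `|v| ^+ 2 <= pderiv2 i (g \o pchart_inv c) (pchart_fun c u) v v].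

Definition differential_nash (f : 'I_n -> (forall i, M i) -> R) u : Prop :=
  game_form_vanishes f u /\ forall i, hessian_posdef i (f i) u.

Definition strict_local_nash (f : 'I_n -> (forall i, M i) -> R) u : Prop :=
  exists2 W : (forall i, set (M i)), (forall i, open (W i) /\ W i (u i)) &
    forall i (p : M i), W i p -> p <> u i -> f i u < f i (dfwith u i p).

End Games.

(* Main.v *)
From HB Require Import structures.
Require Import Defs.
From mathcomp Require Import all_boot all_order all_algebra.
From mathcomp Require Import all_classical all_reals all_analysis.
From mathcomp Require Import lra.

Set Implicit Arguments.
Unset Strict Implicit.
Unset Printing Implicit Defensive.

Import Order.TTheory GRing.Theory Num.Theory.
Import numFieldNormedType.Exports.

Local Open Scope classical_set_scope.
Local Open Scope ring_scope.

(** Fix a player [i].  Only the slice of the cost [f i] through [u] in the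
    [i]-th variable matters, and the product chart [c] in which the Hessian is
    positive-definite turns it into a function [g] on an open set of the Banach
    space [E i].  The two equilibrium conditions become [g'(a) = 0] and
    [g''(a)(v, v) >= alpha |v|^2], so the theorem is the sufficient second-order
    condition for a strict minimum.

    [second_derivative_test] proves that condition without Taylor's formula.
    Along the segment from [a] to [a + v] the mean value theorem gives
    [g (a + v) - g a = g'(a + c v) v] with [0 < c < 1].  Differentiability of
    [g'] at [a] says that [g'(a + c v)] is [c g''(a) v] up to
    [(alpha / 2) c |v|] when [v] is small, so the difference is at least
    [c (alpha / 2) |v|^2].  The uniform bound [alpha] replaces the compactness of
    the unit sphere, which fails in infinite dimension.

    The rest is the passage from the cost on the product to its slice.  Moving
    one coordinate is an affine map of [E i] into the product space, with linear
    part [coord_inj i]; by the chain rule the derivative of the slice is the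
    total derivative precomposed with [coord_inj i] ([frechet_slice]).  Hence the
    slice inherits its regularity from the cost, and the game form evaluated on
    the image of [coord_inj i] is the derivative of the slice of player [i]
    ([game_form_coord]).  The inequality is finally pulled back along the chart
    of [M i], which is injective and continuous near [u i]. *)

(** * Differential calculus in normed spaces *)

(** The derivative of a map known only through a formula valid on a chart domain
    is handled by comparing it with a map that satisfies the formula
    everywhere. *)
Lemma differentiable_near_eq (R : realType) (E F : normedModType R)
    (f g : E -> F) (x : E) :
  (\forall y \near x, f y = g y) -> differentiable f x ->
  differentiable g x.
Proof.
move=> fg df.
have gx : g \o shift x = cst (g x) + 'd f x +o_ (0 : E) id.
  apply/eqaddoP => e e0.
  have /diff_locally/eqaddoP/(_ e e0) fx := df.
  have {}fg' : \forall h \near (0 : E), f (h + x) = g (h + x).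
    have := fg; rewrite (near_shift 0 x) /= subr0 /=; exact.
  apply: filter_app fx; apply: filter_app fg'; near=> h => fgh.
  by rewrite !fctE /= (nbhs_singleton fg) fgh.
have dgf : 'd g x = 'd f x :> (E -> F).
  apply: (diff_unique (diff_continuous df)); exact: gx.
apply/diff_locallyP; split; last by rewrite dgf.
by rewrite dgf; exact: diff_continuous.
Unshelve. all: by end_near. Qed.

Section Precomposition.
Context {R : realType} {E F G : normedModType R}.

Lemma clin_comp_subproof (B : clin F G) (A : clin E F) :
  (fun x => B (A x)) \in @clin_pred R E G.
Proof.
apply/asboolP; split=> [a x y|x]; first by rewrite !linearP.
by apply: continuous_comp; exact: clin_continuous.
Qed.

Definition clin_comp (B : clin F G) (A : clin E F) : clin E G :=
  Clin (clin_comp_subproof B A).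

Lemma clin_norm_comp (B : clin F G) (A : clin E F) :
  `|clin_comp B A| <= `|B| * `|A|.
Proof.
apply: clin_norm_lub => x x1 /=; apply: le_trans (clin_norm_le B (A x)) _.
by rewrite ler_wpM2l ?(normr_ge0 B)// clin_norm_ge.
Qed.

Lemma clin_linear_bounded (f : E -> F) (c : R) :
  linear f -> (forall x, `|f x| <= c * `|x|) -> f \in @clin_pred R E F.
Proof.
move=> lf fc; apply/asboolP; split=> //.
pose h := GRing.isLinear.Build _ _ _ _ f lf.
pose g : {linear E -> F} := HB.pack f h.
apply: (@bounded_linear_continuous _ _ _ g).
apply/linear_boundedP; near=> r => x; apply: le_trans (fc x) _.
by rewrite ler_wpM2r//; near: r; apply: nbhs_pinfty_ge; rewrite num_real.
Unshelve. all: by end_near. Qed.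

End Precomposition.

(** Bounded because the operator norm is submultiplicative. *)
Lemma clin_precomp_subproof (R : realType) (E F G : normedModType R)
    (A : clin E F) :
  (fun B : clin F G => clin_comp B A) \in @clin_pred R (clin F G) (clin E G).
Proof.
apply: (@clin_linear_bounded _ _ _ _ `|A|) => [a B C|B].
  by apply: val_inj; apply/funext => x.
by rewrite mulrC clin_norm_comp.
Qed.

Definition clin_precomp {R : realType} {E F G : normedModType R}
    (A : clin E F) : clin (clin F G) (clin E G) :=
  Clin (clin_precomp_subproof G A).

Section AffineComposition.
Context {R : realType} {E F G : normedModType R}.
Context (A : clin E F) (b : F).

Lemma is_diff_affine (y : E) : is_diff y (fun z => A z + b) A.
Proof.
have dA : is_diff y A A.
  by apply: DiffDef;
    [apply: linear_differentiable; exact: clin_continuous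
    |apply: diff_lin; exact: clin_continuous].
by have := is_diffD dA (is_diff_cst b y); rewrite addr0.
Qed.

(** The derivative of [z |-> A z + b] is the constant [A], so the chain rule only
    precomposes with [A]. *)
Lemma frechet_affine_comp (f : F -> G) (y : E) :
  differentiable f (A y + b) ->
  differentiable (fun z => f (A z + b)) y /\
  frechet (fun z => f (A z + b)) y = clin_comp (frechet f (A y + b)) A.
Proof.
move=> df; have dA := is_diff_affine y.
have D := is_diff_comp dA (differentiableP df).
have df' : differentiable (fun z => f (A z + b)) y by case: D.
split=> //; apply: val_inj => /=; rewrite (frechetE df') (frechetE df).
by have [_ ->] := D.
Qed.

End AffineComposition.

(** The mean value theorem reduces the increment of [g] to its first derivative
    at an intermediate point, where the first-order expansion of [frechet g] at
    [a] applies; so second differentiability at the single point [a] is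
    enough. *)
Lemma second_derivative_test (R : realType) (E : normedModType R) (g : E -> R)
    (a : E) (alpha : R) :
  (\forall y \near a, differentiable g y) ->
  frechet g a = 0 -> differentiable (frechet g) a -> 0 < alpha ->
  (forall v, alpha * `|v| ^+ 2 <= frechet (frechet g) a v v) ->
  \forall y \near a, y <> a -> g a < g y.
Proof.
move=> dg ga0 ddg alpha0 Hpos.
set H := frechet (frechet g) a in Hpos.
(* Half of [alpha] is spent on the error of the expansion, half is kept. *)
have /diff_locally/eqaddoP/(_ (alpha / 2) (divr_gt0 alpha0 (ltr0Sn _ 1))) gH := ddg.
have dg0 : \forall h \near (0 : E), differentiable g (h + a).
  have := dg; rewrite (near_shift 0 a) /= subr0 /=; exact.
have : \forall h \near (0 : E), differentiable g (h + a) /\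
    `|frechet g (h + a) - H h| <= alpha / 2 * `|h|.
  apply: filterS2 dg0 gH => h ? gHh; split=> //.
  move: gHh; rewrite !fctE /= ga0 add0r /H (frechetE ddg); exact.
move/nbhs_norm0P => [r /= r0 near_a].
apply/nbhs_normP; exists r => //= y ya y_a.
pose v := y - a.
have v0 : 0 < `|v| by rewrite normr_gt0 subr_eq0; apply/eqP.
have vr : `|v| < r by rewrite /v distrC.
have near_segment (t : R) : 0 <= t <= 1 -> `|t *: v| < r.
  move=> /andP[t0 t1]; rewrite normrZ ger0_norm//.
  by apply: le_lt_trans vr; rewrite ler_piMl.
have derive_segment (t : R) : 0 <= t <= 1 ->
    is_derive t (1 : R) (fun s : R => g (s *: v + a)) (frechet g (t *: v + a) v) /\
    {for t, continuous (fun s : R => g (s *: v + a))}.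
  move=> /near_segment/near_a[dgt _].
  have D : is_diff t (fun s : R => g (s *: v + a))
     ('d g (t *: v + a) \o (fun s : R => s *: v)).
    apply: (@is_diff_comp _ _ _ _ (fun s : R => s *: v + a)); last exact: differentiableP.
    have := is_diffD (is_diff_scalel t v) (is_diff_cst a t).
    by rewrite addr0.
  have [dD eD] := D.
  split; last exact: differentiable_continuous.
  apply: DeriveDef; first exact: diff_derivable.
  by rewrite deriveE// eD /= scale1r frechetE.
have [c c01] : exists2 c : R, c \in `]0, 1[ &
    g (1 *: v + a) - g (0 *: v + a) = frechet g (c *: v + a) v * (1 - 0).
  apply: (@MVT R (fun s => g (s *: v + a)) (fun s => frechet g (s *: v + a) v)).
  - exact: ltr01.
  - move=> c; rewrite in_itv /= => /andP[c0 c1].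
    by have [] := derive_segment c; rewrite ?ltW.
  - apply: continuous_in_subspaceT => t; rewrite inE /= in_itv /= => t01.
    by have [] := derive_segment t t01.
rewrite scale1r scale0r add0r subr0 mulr1 /v subrK -/v => mvt.
have {c01}[c0 c1] : 0 < c /\ c < 1 by move: c01; rewrite in_itv => /andP[].
rewrite -subr_gt0 mvt.
have c01 : 0 <= c <= 1 by rewrite !ltW.
have [_ gHc] := near_a (c *: v) (near_segment c c01).
have := le_trans (clin_norm_le (frechet g (c *: v + a) - H (c *: v)) v)
  (ler_wpM2r (normr_ge0 v) gHc).
have -> : (frechet g (c *: v + a) - H (c *: v)) v =
    frechet g (c *: v + a) v - c * H v v.
  by rewrite linearZ.
(* [lower] bounds [frechet g (c *: v + a) v - c * H v v] below by
   [- (alpha / 2) * c * |v| ^+ 2], while [c * H v v >= c * alpha * |v| ^+ 2]. *)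
rewrite normrZ (gtr0_norm c0) ler_norml => /andP[lower _].
have := Hpos v; set hvv := H v v in lower *; set d := frechet _ _ _ in lower *.
have cv : 0 < alpha * c * `|v| ^+ 2 by rewrite !mulr_gt0// exprn_gt0.
rewrite -(ler_pM2l c0) => upper.
nra.
Qed.

(** * Moving one coordinate *)

Section OneCoordinate.
Context (I : eqType) (T : I -> Type).
Implicit Types x : forall i, T i.

Lemma dfwith_same x i : dfwith x i (x i) = x.
Proof. by apply: functional_extensionality_dep => j; case: dfwithP. Qed.

Lemma dfwith_dfwith x i (y z : T i) : dfwith (dfwith x i y) i z = dfwith x i z.
Proof.
apply: functional_extensionality_dep => j.
by case: dfwithP => [|k ik]; rewrite ?dfwithin ?dfwithout.
Qed.

End OneCoordinate.

Section Slices.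
Context {R : realType} {n : nat} {E : 'I_n -> completeNormedModType R}.
Implicit Types x : bprod E.

Lemma bprodP x y : (forall i, x i = y i) -> x = y.
Proof. exact: functional_extensionality_dep. Qed.

Lemma coord_inj_subproof i :
  (fun v : E i => dfwith (0 : bprod E) i v : bprod E) \in @clin_pred R (E i) (bprod E).
Proof.
apply: (@clin_linear_bounded _ _ _ _ 1) => [a v w|v].
  apply: bprodP => j; rewrite -[RHS]/(a *: dfwith (0 : bprod E) i v j + dfwith (0 : bprod E) i w j).
  have [<-|ij] := eqVneq i j; first by rewrite !dfwithin.
  by rewrite !dfwithout// scaler0 addr0.
rewrite mul1r; apply: bprod_norm_lub => // j.
by case: dfwithP => // k _; rewrite normr0.
Qed.

Definition coord_inj i : clin (E i) (bprod E) := Clin (coord_inj_subproof i).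

(** A slice is the composite of the function with an affine map. *)
Lemma dfwith_affine x i (y : E i) :
  dfwith x i y = coord_inj i y + dfwith x i (0 : E i) :> bprod E.
Proof.
apply: bprodP => j.
rewrite -[RHS]/(dfwith (0 : bprod E) i y j + dfwith x i (0 : E i) j).
have [<-|ij] := eqVneq i j; first by rewrite !dfwithin addr0.
by rewrite !dfwithout// add0r.
Qed.

Lemma frechet_slice (G : normedModType R) (F : bprod E -> G) x i (y : E i) :
  differentiable F (dfwith x i y : bprod E) ->
  differentiable (fun z : E i => F (dfwith x i z)) y /\
  frechet (fun z : E i => F (dfwith x i z)) y =
    clin_comp (frechet F (dfwith x i y)) (coord_inj i).
Proof.
have -> : (fun z : E i => F (dfwith x i z)) =
    (fun z => F (coord_inj i z + dfwith x i (0 : E i))).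
  by apply/funext => z; rewrite dfwith_affine.
by rewrite dfwith_affine; exact: frechet_affine_comp.
Qed.

(** Moving the [i]-th coordinate of the base point does not change the slice, so
    iterated partial derivatives are derivatives of one function of [E i]. *)
Lemma pderiv_dfwith (G : normedModType R) i (F : bprod E -> G) x (y : E i) :
  pderiv i F (dfwith x i y) = frechet (fun z : E i => F (dfwith x i z)) y.
Proof.
rewrite /pderiv dfwithin; congr (frechet _ y).
by apply/funext => z; rewrite dfwith_dfwith.
Qed.

(** The slice has a derivative that is differentiable at [x i] because, near
    [x i], it is the slice of [frechet F] followed by the continuous linear map
    [clin_precomp (coord_inj i)]. *)
Lemma partial_second_derivative_test i (F : bprod E -> R) x (alpha : R) :
  (\forall y \near x i, differentiable F (dfwith x i y : bprod E)) ->
  differentiable (frechet F) x -> pderiv i F x = 0 -> 0 < alpha ->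
  (forall v, alpha * `|v| ^+ 2 <= pderiv2 i F x v v) ->
  \forall y \near x i, y <> x i -> F x < F (dfwith x i y).
Proof.
move=> dF ddF Fx0 alpha0 pos.
pose g (y : E i) := F (dfwith x i y).
have Fg y : pderiv i F (dfwith x i y) = frechet g y by exact: pderiv_dfwith.
have dg : \forall y \near x i, differentiable g y.
  by apply: filterS dF => y /frechet_slice[].
have ddg : differentiable (frechet g) (x i).
  have ddFx : differentiable (frechet F) (dfwith x i (x i) : bprod E).
    by rewrite dfwith_same.
  have [dS _] := frechet_slice ddFx.
  have dpre : differentiable
      (clin_precomp (coord_inj i) \o (fun y : E i => frechet F (dfwith x i y))) (x i).
    apply: differentiable_comp => //.
    by apply: linear_differentiable; exact: clin_continuous.
  apply: differentiable_near_eq dpre.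
  by apply: filterS dF => y /frechet_slice[].
have -> : F x = g (x i) by rewrite /g dfwith_same.
apply: (second_derivative_test dg _ ddg alpha0).
  by rewrite -Fg dfwith_same.
move=> v; apply: le_trans (pos v) _; rewrite /pderiv2.
by rewrite (_ : (fun y : E i => pderiv i F (dfwith x i y)) = frechet g)//; apply/funext.
Qed.

End Slices.

(** * Games *)

Section Games.
Context {R : realType} {n : nat} {E : 'I_n -> completeNormedModType R}.
Context {M : forall i, banachManifold (E i)}.
Implicit Types (c : @pchart R n E M) (u : forall i, M i).

(** The [j]-th summand of the game form only sees the [j]-th component, so the
    [i]-th partial derivative of the cost of player [i] is all that remains. *)
Lemma game_form_coord (f : 'I_n -> (forall i, M i) -> R) c u i (v : E i) :
  game_form f c u (coord_inj i v) = cost_diff (f i) c u (coord_inj i v).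
Proof.
rewrite /game_form (big_morph (fun A : clin (bprod E) R => A (coord_inj i v))
  (id1 := 0) (op1 := +%R))//.
rewrite (bigD1 i)//= big1 ?addr0 => [|j ji].
  congr (cost_diff _ _ _ _); apply: bprodP => k.
  by rewrite /keep; case: eqVneq => // ki; rewrite dfwithout// eq_sym.
rewrite (_ : keep j _ = 0) ?linear0//; apply: bprodP => k.
by rewrite /keep; case: eqVneq => // ->; rewrite dfwithout// eq_sym.
Qed.

Lemma pchart_fun_dfwith c u i (p : M i) :
  pchart_fun c (dfwith u i p) = dfwith (pchart_fun c u) i (cfun (c i) p).
Proof.
apply: bprodP => j; rewrite /pchart_fun.
by have [<-|ij] := eqVneq i j; [rewrite !dfwithin|rewrite !dfwithout].
Qed.

Lemma pchart_dom_dfwith c u i (p : M i) :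
  pchart_dom c u -> cdom (c i) p -> pchart_dom c (dfwith u i p).
Proof. by move=> cu cp j; case: dfwithP. Qed.

Lemma pchart_funK c u : pchart_dom c u -> pchart_inv c (pchart_fun c u) = u.
Proof. by move=> cu; apply: functional_extensionality_dep => i; exact: cfunK. Qed.

(** In the chart where the Hessian is positive-definite, the slice of [f i]
    satisfies the second derivative test; the resulting neighbourhood of the image
    of [u i] is pulled back along the chart of [M i]. *)
Lemma strict_min_coord (f : 'I_n -> (forall i, M i) -> R) u i :
  C2 (f i) -> game_form_vanishes f u -> hessian_posdef i (f i) u ->
  \forall p \near u i, p <> u i -> f i u < f i (dfwith u i p).
Proof.
move=> C2f f0 [c [cat cu [alpha alpha0 pos]]].
have [dF [ddF _]] := C2f c cat.
set F := f i \o pchart_inv c in dF ddF pos.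
set x := pchart_fun c u in pos.
have img p : cdom (c i) p -> (pchart_fun c @` pchart_dom c) (dfwith x i (cfun (c i) p)).
  move=> cp; exists (dfwith u i p); last by rewrite pchart_fun_dfwith.
  exact: pchart_dom_dfwith.
have dslice : \forall y \near x i, differentiable F (dfwith x i y : bprod E).
  have : nbhs (x i) (cfun (c i) @` cdom (c i)).
    by apply: open_nbhs_nbhs; split; [exact: cimg_open|exists (u i)].
  by apply: filterS => y [p cp <-]; apply: dF; exact: img.
have dFx : differentiable F x by apply: dF; exists u.
have Fx0 : pderiv i F x = 0.
  apply: val_inj; apply/funext => v /=.
  rewrite /pderiv (frechet_slice _).2 ?dfwith_same//=.
  by have := f0 c cat cu; rewrite -(game_form_coord f c u) => ->.
have xmin : \forall y \near x i, y <> x i -> F x < F (dfwith x i y).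
  by apply: (partial_second_derivative_test dslice _ Fx0 alpha0 pos); apply: ddF; exists u.
have cont := cfun_continuous (cu i) xmin.
have dom : nbhs (u i) (cdom (c i)).
  by apply: open_nbhs_nbhs; split; [exact: cdom_open|exact: cu].
apply: filterS2 dom cont => p cp min_p pu.
have := min_p; rewrite /F /= -pchart_fun_dfwith !pchart_funK//; last exact: pchart_dom_dfwith.
(* A point of the chart domain with the same image as [u i] is [u i]. *)
apply=> cpu; apply: pu.
by rewrite -(cfunK cp) cpu cfunK.
Qed.

End Games.

Theorem theorem1 (R : realType) (n : nat) (E : 'I_n -> completeNormedModType R)
    (M : forall i : 'I_n, banachManifold (E i))
    (f : 'I_n -> (forall i : 'I_n, M i) -> R)
    (hf : forall i : 'I_n, C2 (f i)) (u : forall i : 'I_n, M i)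
    (hu : differential_nash f u) :
  strict_local_nash f u.
Proof.
have [f0 pos] := hu.
(* Taking the interior of the whole set of unprofitable deviations avoids
   choosing a neighbourhood for each player. *)
exists (fun i => [set p : M i | p <> u i -> f i u < f i (dfwith u i p)]^°).
  move=> i; split; first exact: open_interior.
  exact: (strict_min_coord (hf i) f0 (pos i)).
by move=> i p; apply: interior_subset.
Qed.
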